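(* Let $G,H$ be two graphs, $1 \in G$ a basepoint, $X,Y$ two median spaces, and $\Phi : G \hookrightarrow X$, $\Psi : H \hookrightarrow Y$ two injective maps. Assume that $H$ is uniformly locally finite. If $\Phi$ and $\Psi$ are coarse embeddings, then the map $\Phi \wr \Psi : (G,1) \wr H \to ((X,\Phi(1)) \circledast Y,\delta)$ is a coarse embedding.
   Context: Graphs are connected, identified with their vertex-sets, and viewed as metric spaces through the shortest-path metric. A graph is uniformly locally finite if there is a uniform upper bound on the degrees of its vertices. Wreath product of graphs: given graphs $G,H$ and a basepoint $1 \in G$, let $G^{(H)}$ denote the set of maps $c : H \to G$ such that $c(k)=1$ for all but finitely many $k \in H$. $(G,1)\wr H$ is the graph whose vertices are the pairs $(c,h)$ with $c \in G^{(H)}$ and $h \in H$, and in which $(c_1,h_1)$ and $(c_2,h_2)$ are linked by an edge if either $c_1=c_2$ and $h_1,h_2$ are adjacent in $H$, or $h_1=h_2$ and $c_1,c_2$ differ only at $h_1=h_2$, with $c_1(h_1),c_2(h_1)$ adjacent in $G$. A map $f : R \to S$ between metric spaces is a coarse embedding if there exist non-decreasing functions $\rho_-,\rho_+ : [0,\infty) \to [0,\infty)$ with $\rho_-(t) \to \infty$ as $t \to \infty$ such that $\rho_-(d(a,b)) \leq d(f(a),f(b)) \leq \rho_+(d(a,b))$ for all $a,b \in R$. In a metric space $X$, the interval between $x,y$ is $I(x,y) = \{ z \in X \mid d(x,y)=d(x,z)+d(z,y)\}$, and $X$ is median if, for all $x,y,z\in X$, the intersection $I(x,y) \cap I(y,z)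 \cap I(x,z)$ is a single point. Let $Y$ be a median space. A subspace $C \subset Y$ is convex if $I(x,y)\subset C$ for all $x,y \in C$. A halfspace is a convex subspace whose complement is convex, and a hyperplane is a pair $\{D,D^c\}$ where $D$ and $D^c$ are non-empty halfspaces. $\mathcal{W}(x\mid y)$ denotes the set of hyperplanes separating $x$ and $y$, i.e. with one point in $D$ and the other in $D^c$. It is known (Chatterji-Drutu-Haglund) that the set of hyperplanes of $Y$ carries a $\sigma$-algebra and a measure $\mu$ such that each $\mathcal{W}(x \mid y)$ is measurable with $\mu(\mathcal{W}(x\mid y))=d(x,y)$; fix such a measure. For $F \subset Y$, $\mathcal{H}(F)$ is the set of hyperplanes separating two points of $F$; when the convex hull of $F$ is the convex hull of finitely many points, $\mathcal{H}(F)$ is measurable of finite measure and $\mu(F) := \mu(\mathcal{H}(F))$. $\mathcal{F}(Y)$ denotes the set of non-empty convex subspaces of $Y$ that are convex hulls of finitely many points. Diadem product: given median spaces $X,Y$ and a basepoint $x_0 \in X$, let $X^{(Y)}$ be the set of maps $\varphi : Y \to X$ with $\varphi(y)=x_0$ for all but finitely many $y$. $(X,x_0) \circledast Y$ is the set of pairs $(C,\varphi)$ with $C \in \mathcal{F}(Y)$ and $\varphi \in X^{(Y)}$, endowed with the metric $$\delta((C_1,\varphi_1),(C_2,\varphi_2)) = 2 \mu(C_1 \cup C_2 \cup \varphi_1 \Delta \varphi_2)- \mu(C_1)- \mu(C_2)+ \sum_{y \in Y} d(\varphi_1(y), \varphi_2(y)),$$ where $\varphi_1 \Delta \varphi_2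 = \{ y \in Y \mid \varphi_1(y) \neq \varphi_2(y)\}$. Wreath product of maps: $\Phi \wr \Psi$ sends $(c,h)$ to $(\{\Psi(h)\}, \varphi_c)$, where $\varphi_c : Y \to X$ is given by $\varphi_c(y)=\Phi(c(\Psi^{-1}(y)))$ if $y \in \mathrm{Im}(\Psi)$ and $\varphi_c(y)=\Phi(1)$ otherwise. *)

(* Defs.v *)
From HB Require Import structures.
From mathcomp Require Import all_boot all_order all_algebra.
From mathcomp Require Import all_classical all_reals.
From mathcomp Require Import topology normedtype measure.

Set Implicit Arguments.
Unset Strict Implicit.
Unset Printing Implicit Defensive.

Import Order.TTheory GRing.Theory Num.Theory.

Local Open Scope classical_set_scope.
Local Open Scope ring_scope.

Fixpoint walk (V : Type) (e : V -> V -> Prop) (n : nat) (x y : V) : Prop :=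
  if n is n'.+1 then exists2 z, e x z & walk e n' z y else x = y.

Record graph := Graph {
  vertex :> Type;
  adj : vertex -> vertex -> Prop;
  adj_sym : forall x y, adj x y -> adj y x;
  adj_irr : forall x, ~ adj x x;
  adj_conn : forall x y, exists n, walk adj n x y }.

Section GraphMetric.
Variable G : graph.

Fact gdist_subproof (x y : G) : exists n, `[< walk (@adj G) n x y >].
Proof. by have [n xy] := adj_conn x y; exists n; apply/asboolP. Qed.

Definition gdist (x y : G) : nat := ex_minn (gdist_subproof x y).

Definition uniformly_locally_finite : Prop :=
  exists N : nat, forall x : G, ([set y | adj x y] #<= `I_N)%card.

End GraphMetric.

(* Maps from T to U that take the value u0 at all but finitely many points. *)
Record fsmap (T U : Type) (u0 : U) := FSMap {
  fsmap_fun :> T -> U;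
  fsmap_fin : finite_set [set t | fsmap_fun t <> u0] }.

Lemma fsmapP (T U : Type) (u0 : U) (c d : fsmap T u0) : c =1 d -> c = d.
Proof.
case: c d => [c cf] [d df] /= /funext cd.
by subst d; congr FSMap; exact: Prop_irrelevance.
Qed.

Section WalkTheory.
Variables (V : Type) (e : V -> V -> Prop).

Lemma walk_trans m n x y z :
  walk e m x y -> walk e n y z -> walk e (m + n) x z.
Proof.
elim: m x => [x /= -> //|m IH x /= [w xw wy] yz].
by exists w => //; exact: IH.
Qed.

Lemma walk_map (W : Type) (e' : W -> W -> Prop) (f : V -> W) n x y :
  (forall a b, e a b -> e' (f a) (f b)) ->
  walk e n x y -> walk e' n (f x) (f y).
Proof.
move=> ef; elim: n x => [x /= -> //|n IH x /= [w xw wy]].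
by exists (f w); [exact: ef|exact: IH].
Qed.

End WalkTheory.

Section WreathProduct.
Variables (G : graph) (o : G) (H : graph).

Definition wreath_adj (p q : fsmap H o * H) : Prop :=
  (p.1 = q.1 /\ adj p.2 q.2) \/
  [/\ p.2 = q.2, forall k, k <> p.2 -> p.1 k = q.1 k & adj (p.1 p.2) (q.1 p.2)].

Fact wreath_sym p q : wreath_adj p q -> wreath_adj q p.
Proof.
case=> [[pq1 /adj_sym pq2]|[pq2 pq pq1]]; first by left.
right; split=> //; last by rewrite -pq2; exact: adj_sym.
by move=> k; rewrite -pq2 => /pq.
Qed.

Fact wreath_irr p : ~ wreath_adj p p.
Proof. by case=> [[_]|[_ _]]; exact: adj_irr. Qed.

Fact upd_subproof (c : fsmap H o) (h : H) (g : G) :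
  finite_set [set k | (if pselect (k = h) then g else c k) <> o].
Proof.
apply: (@sub_finite_set _ _ ([set h] `|` [set k | c k <> o])).
  by move=> k /=; case: pselect => [kh _|kh ck]; [left|right].
by rewrite finite_setU; split; [exact: finite_set1|exact: fsmap_fin].
Qed.

Definition upd c h g : fsmap H o := FSMap (@upd_subproof c h g).

Fact wreath_conn p q : exists n, walk wreath_adj n p q.
Proof.
have move_cursor c h k : exists n, walk wreath_adj n (c, h) (c, k).
  have [n hk] := adj_conn h k; exists n.
  by apply: (walk_map (f := fun x => (c, x))) hk => a b ab; left.
have move_lamp c h g : exists n, walk wreath_adj n (c, h) (upd c h g, h).
  have [n cg] := adj_conn (c h) g; exists n.
  have {1}-> : c = upd c h (c h).
    by apply: fsmapP => k /=; case: pselect => //= kh; rewrite kh.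
  apply: (walk_map (f := fun x => (upd c h x, h))) cg => a b ab; right.
  by split=> //= [k kh|]; case: pselect.
have fix_lamps (s : seq {classic H}) : forall c d h k,
    (forall x : {classic H}, x \notin s -> (c : fsmap H o) x = (d : fsmap H o) x) ->
    exists n, walk wreath_adj n (c, h) (d, k).
  elim: s => [|a s IH] c d h k cd.
    by have -> : c = d by apply: fsmapP => x; exact: cd.
  have [n1 w1] := move_cursor c h a.
  have [n2 w2] := move_lamp c a (d a).
  have [x|n3 w3] := IH (upd c a (d a)) d a k.
    move=> xs /=; case: pselect => [xa|xa] /=; first by rewrite xa.
    by apply: cd; rewrite in_cons negb_or xs andbT; apply/eqP.
  by exists (n1 + (n2 + n3))%N; exact: walk_trans w1 (walk_trans w2 w3).
case: p q => [c h] [d k].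
have : finite_set ([set x : {classic H} | c x <> o] `|` [set x | d x <> o]).
  by rewrite finite_setU; split; exact: fsmap_fin.
move=> /finite_seqP[s sE]; apply: (fix_lamps s) => x xs.
have : ~ ([set x : {classic H} | c x <> o] `|` [set x | d x <> o]) x.
  by rewrite sE /=; exact/negP.
by move=> /not_orP[/contrapT-> /contrapT->].
Qed.

Definition wreath : graph := Graph wreath_sym wreath_irr wreath_conn.

End WreathProduct.

Definition coarse_embedding (R : realType) (A B : Type)
    (dA : A -> A -> R) (dB : B -> B -> R) (f : A -> B) : Prop :=
  exists rho_m rho_p : R -> R,
  [/\ forall t, 0 <= t -> 0 <= rho_m t /\ 0 <= rho_p t,
      forall s t, 0 <= s -> s <= t -> rho_m s <= rho_m t /\ rho_p s <= rho_p t,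
      rho_m t @[t --> +oo] --> +oo &
      forall a b, rho_m (dA a b) <= dB (f a) (f b) <= rho_p (dA a b)].

Section Median.
Variables (R : realType) (Y : metricType R).
Implicit Types (x y z : Y) (C D F : set Y).

Definition interval x y : set Y :=
  [set z | mdist x y = mdist x z + mdist z y].

Definition median_space : Prop :=
  forall x y z, exists m,
    interval x y `&` interval y z `&` interval x z = [set m].

Definition convex C : Prop :=
  forall x y, C x -> C y -> interval x y `<=` C.

Definition halfspace D : Prop := convex D /\ convex (~` D).

(* The hyperplane {D, D^c} is encoded as the unordered pair [set D; ~` D]. *)
Definition hyperplanes : set (set (set Y)) :=
  [set W | exists D, [/\ halfspace D, halfspace (~` D), D !=set0, ~` D !=set0 &
                         W = [set D; ~` D]]].

Definition separating x y : set (set (set Y)) :=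
  [set W | hyperplanes W /\ exists D, [/\ W D, D x & (~` D) y]].

Definition hyperplanes_of F : set (set (set Y)) :=
  [set W | exists x y, [/\ F x, F y & separating x y W]].

Definition convex_hull F : set Y :=
  \bigcap_(C in [set C | convex C /\ F `<=` C]) C.

Definition finite_hull C : Prop :=
  C !=set0 /\ exists2 F, finite_set F & C = convex_hull F.

(* [hm_algebra] is a sigma-algebra on [hyperplanes], which may be empty, whereas
   the library only puts measures on pointed types.  The measure is therefore
   carried by the ambient type [set (set Y)], with the sigma-algebra generated
   there by [hm_algebra]: this adds only sets [A `|` ~` hyperplanes] with [A] in
   [hm_algebra], which play no role below. *)
Record hyperplane_measure := HyperplaneMeasure {
  hm_algebra : set (set (set (set Y)));
  hm_sigma_algebra : sigma_algebra hyperplanes hm_algebra;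
  hm_measure :> {measure set (g_sigma_algebraType hm_algebra) -> \bar R};
  hm_measurable : forall x y, hm_algebra (separating x y);
  hm_separating : forall x y, hm_measure (separating x y) = (mdist x y)%:E }.

Definition hmu (mu : hyperplane_measure) F : R := fine (mu (hyperplanes_of F)).

End Median.

Section Diadem.
Variables (R : realType) (X : metricType R) (x0 : X) (Y : metricType R).

Definition diadem : Type := {C : set Y | finite_hull C} * fsmap Y x0.

Definition diadem_dist (mu : hyperplane_measure Y) (p q : diadem) : R :=
  let C1 := sval p.1 in let C2 := sval q.1 in
  2 * hmu mu (C1 `|` C2 `|` [set y | p.2 y <> q.2 y]) - hmu mu C1 - hmu mu C2
  + \sum_(y \in [set: Y]) mdist (p.2 y) (q.2 y).

End Diadem.

Section WreathMap.
Variables (R : realType) (G H : graph) (o : G) (X Y : metricType R).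
Variables (Phi : G -> X) (Psi : H -> Y).

Fact finite_hull1 (y : Y) : finite_hull [set y].
Proof.
split; first by exists y.
exists [set y]; first exact: finite_set1.
apply/seteqP; split=> [_ -> C [_]|z]; first exact.
apply; split=> // _ _ -> -> w; rewrite /interval /= mdistxx => ywy.
apply/esym/mdist_positivity/eqP; rewrite eq_le mdist_ge0 andbT.
by rewrite ywy lerDl mdist_ge0.
Qed.

(* Psi^-1 (y) is a chosen preimage of y: it is unique when Psi is injective. *)
Definition wreath_lamp (c : H -> G) (y : Y) : X :=
  if pselect (exists h, Psi h = y) is left e
  then Phi (c (projT1 (cid e))) else Phi o.

Fact wreath_lamp_fin (c : fsmap H o) :
  finite_set [set y | wreath_lamp c y <> Phi o].
Proof.
apply: (@sub_finite_set _ _ (Psi @` [set h | c h <> o])); last first.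
  exact/finite_image/fsmap_fin.
move=> y; rewrite /wreath_lamp /=; case: pselect => // e.
case: cid => h /= hy co; exists h => // ch.
by apply: co; rewrite ch.
Qed.

Definition wreath_map (p : wreath o H) : diadem (Phi o) Y :=
  (exist _ _ (finite_hull1 (Psi p.2)), FSMap (wreath_lamp_fin p.1)).

End WreathMap.

Arguments wreath_map {R G H} o {X Y} Phi Psi p.

(* Main.v *)
(* Singletons separate no points, so the distance between the images of (c, h)
   and (d, k) is twice the measure of F = {Psi h, Psi k} `|` Psi (D), where D is
   the set of lamps on which c and d differ, plus the sum of the distances
   between the values of the lamps.
   A path of length n from (c, h) to (d, k) visits D, so D has at most n points,
   all within n of h; since every hyperplane separating two points of F
   separates one of them from Psi h, the measure of F is at most the sum of the
   distances from Psi h to the points of F.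
   Conversely, the measure of F bounds the distance in Y between any two points
   of F, hence the diameter in H of D `|` {h, k}; as H is uniformly locally
   finite, this also bounds the cardinal of D.  Visiting the points of D one
   after the other then gives a short path from (c, h) to (d, k). *)
Require Import Defs.
From mathcomp Require Import all_boot all_order all_algebra.
From mathcomp Require Import all_classical all_reals.
From mathcomp Require Import topology normedtype measure.

Import Order.TTheory GRing.Theory Num.Theory.

Local Open Scope classical_set_scope.
Local Open Scope ring_scope.

Set Implicit Arguments.
Unset Strict Implicit.
Unset Printing Implicit Defensive.

(** * Coarse embeddings as two-sided control of distances *)

(* The optimal bounds are [inf] and [sup] of the distances of the images; adding
   [t, +oo[ to the former and 0 to the latter keeps these sets non-empty, and the
   lower bound proper when the distances of [A] are bounded. *)
Lemma coarse_embeddingP (R : realType) (A B : Type) (dA : A -> A -> R)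
    (dB : B -> B -> R) (f : A -> B) :
  (forall a b, 0 <= dA a b) -> (forall x y, 0 <= dB (f x) (f y)) ->
  coarse_embedding dA dB f <->
  (forall r, exists s, forall a b, dA a b <= r -> dB (f a) (f b) <= s) /\
  (forall r, exists s, forall a b, dB (f a) (f b) <= r -> dA a b <= s).
Proof.
move=> dA0 dB0; split.
  move=> [rm [rp [_ mono rmy bnd]]]; split=> r.
    exists (rp r) => a b abr; have /andP[_ /le_trans] := bnd a b; apply.
    by have [] := mono _ _ (dA0 a b) abr.
  have [M [_ Mr]] : \forall t \near +oo, r < rm t.
    exact: cvgry_gt.
  (* The monotonicity of [rm] is available only from 0 on, and [r < rm t] only strictly beyond
     [M]. *)
  pose t := `|M| + 1; exists t => a b abr.
  have t0 : 0 <= t by rewrite addr_ge0.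
  have Mt : M < t by rewrite (le_lt_trans (ler_norm M))// ltrDl.
  rewrite leNgt; apply/negP => /ltW tab.
  have := lt_le_trans (Mr _ Mt) (mono _ _ t0 tab).1.
  have /andP[+ _] := bnd a b => ab /lt_le_trans /(_ ab).
  by rewrite ltNge abr.
move=> [up low].
pose Lo t := [set s | exists a b, t <= dA a b /\ s = dB (f a) (f b)]
             `|` [set s | t <= s].
pose Up t := [set s | exists a b, dA a b <= t /\ s = dB (f a) (f b)]
             `|` [set 0].
have LoN t : Lo t !=set0 by exists t; right => /=.
have Lo0 t : 0 <= t -> lbound (Lo t) 0.
  by move=> t0 s [[a [b [_ ->]]]//|/=]; exact: le_trans.
have UpN t : Up t !=set0 by exists 0; right.
have UpB t : has_ubound (Up t).
  have [M tM] := up t; exists (Num.max M 0) => s [[a [b [/tM abM ->]]]|/= ->].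
    by rewrite le_max abM.
  by rewrite le_max lexx orbT.
exists (fun t => inf (Lo t)), (fun t => sup (Up t)); split.
- move=> t t0; split; first exact: lb_le_inf (Lo0 _ t0).
  by apply: ub_le_sup => //; right.
- move=> s t s0 st; split.
    apply: lb_le_inf => // u tu; apply: ge_inf; first by exists 0; exact: Lo0.
    case: tu => [[a [b [tab ->]]]|/= tu]; [left|right => /=].
      by exists a, b; split => //; exact: le_trans tab.
    exact: le_trans tu.
  apply: ge_sup => // u su; apply: ub_le_sup => //.
  case: su => [[a [b [tab ->]]]|/= tu]; [left|right => //].
  by exists a, b; split => //; exact: le_trans st.
- apply/cvgryPge => T; have [M TM] := low T.
  (* Pairs further apart than [M] have images more than [T] apart; exceeding [T] as well deals with
     the added ray. *)
  exists (Num.max M T); split; first exact: num_real.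
  move=> t; rewrite gt_max => /andP[Mt Tt]; apply: lb_le_inf => // u.
  case=> [[a [b [tab ->]]]|/= tu]; last exact: ltW (lt_le_trans Tt tu).
  rewrite leNgt; apply/negP => /ltW /TM abM.
  by have := lt_le_trans Mt (le_trans tab abM); rewrite ltxx.
- move=> a b; apply/andP; split.
    apply: ge_inf; first by exists 0; exact: Lo0.
    by left; exists a, b.
  by apply: ub_le_sup => //; left; exists a, b.
Qed.

(** * The path metric of a graph and its balls *)

Lemma gdist_walk (G : graph) (x y : G) : walk (@adj G) (gdist x y) x y.
Proof. by rewrite /gdist; case: ex_minnP => n /asboolP. Qed.

Lemma gdist_le (G : graph) n (x y : G) :
  walk (@adj G) n x y -> (gdist x y <= n)%N.
Proof.
by move=> w; rewrite /gdist; case: ex_minnP => m _; apply; apply/asboolP.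
Qed.

Lemma gdistxx (G : graph) (x : G) : gdist x x = 0%N.
Proof. by apply/eqP; rewrite -leqn0; exact: gdist_le. Qed.

Lemma gdist_triangle (G : graph) (y x z : G) :
  (gdist x z <= gdist x y + gdist y z)%N.
Proof. by apply/gdist_le/walk_trans; exact: gdist_walk. Qed.

Lemma gdist_adj (G : graph) (x y : G) : adj x y -> (gdist x y <= 1)%N.
Proof. by move=> xy; apply: gdist_le; exists y. Qed.

(** Graph distances are integers, so truncation turns real bounds on them into integer ones. *)
Lemma graph_coarse_embeddingP (R : realType) (G : graph) (B : Type)
    (dB : B -> B -> R) (f : G -> B) : (forall x y, 0 <= dB (f x) (f y)) ->
  coarse_embedding (fun a b : G => (gdist a b)%:R : R) dB f <->
  (forall n, exists s, forall a b, (gdist a b <= n)%N -> dB (f a) (f b) <= s) /\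
  (forall r, exists n, forall a b, dB (f a) (f b) <= r -> (gdist a b <= n)%N).
Proof.
move=> dB0; rewrite coarse_embeddingP//; split=> -[up low]; split=> r.
- have [s sP] := up r%:R; exists s => a b abr.
  by apply: sP; rewrite ler_nat.
- have [s sP] := low r; exists (Num.truncn s) => a b /sP abs.
  by rewrite truncn_ge_nat// (le_trans _ abs).
- have [s sP] := up (Num.truncn r); exists s => a b abr.
  by apply: sP; rewrite truncn_ge_nat// (le_trans _ abr).
- have [n nP] := low r; exists n%:R => a b /nP.
  by rewrite ler_nat.
Qed.

(** Induction on the radius: a point other than [h] in the ball of radius [n.+1] lies within [n] of
    one of the at most [N] neighbours of [h], so [K] becomes [N * K + 1]. *)
Lemma ball_cover (H : graph) : uniformly_locally_finite H ->
  forall n, exists K, forall h : H, exists2 s : seq {classic H},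
    (size s <= K)%N & forall k : H, (gdist h k <= n)%N -> (k : {classic H}) \in s.
Proof.
move=> [N HN].
have nbr (h : H) : exists2 s : seq {classic H}, (size s <= N)%N &
    forall k : H, adj h k -> (k : {classic H}) \in s.
  pose A : set {classic H} := [set k | adj h k].
  have Afin : finite_set A by exact: card_le_finite (HN h) (finite_II N).
  exists (finmap.enum_fset (fset_set A)); first exact/geq_card_fset_set/HN.
  by move=> k hk; rewrite in_fset_set// inE.
elim=> [|n [K IH]].
  exists 1%N => h; exists [:: (h : {classic H})] => // k.
  rewrite leqn0 => /eqP hk; have := gdist_walk h k; rewrite hk /= => ->.
  by rewrite mem_head.
pose b h := s2val (cid2 (IH h)).
have bK h : (size (b h) <= K)%N by rewrite /b; case: cid2.
have bP h (k : H) : (gdist h k <= n)%N -> (k : {classic H}) \in b h.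
  by rewrite /b; case: cid2 => /= s _; exact.
exists (N * K).+1 => h; have [s sN sP] := nbr h.
exists ((h : {classic H}) :: flatten [seq b x | x : {classic H} <- s]).
  rewrite /= ltnS size_flatten /shape -map_comp sumnE big_map.
  apply: (@leq_trans (\sum_(x <- s) K)%N); first by apply: leq_sum => x _; exact: bK.
  by rewrite big_const_seq iter_addn_0 count_predT mulnC leq_mul2r sN orbT.
move=> k hk; rewrite in_cons; apply/orP; have := gdist_walk h k.
case: (gdist h k) hk => [_ /= ->|m mn /= [z hz zk]]; first by left.
right; apply/flattenP; exists (b z).
  by apply: (map_f (fun x : {classic H} => b x)); exact: sP.
exact/bP/(leq_trans (gdist_le zk)).
Qed.

(** * Paths in the wreath product *)

Lemma upd_same (G : graph) (o : G) (H : graph) (c : fsmap H o) h g :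
  upd c h g h = g.
Proof. by rewrite /=; case: pselect. Qed.

Lemma upd_other (G : graph) (o : G) (H : graph) (c : fsmap H o) h g k :
  k <> h -> upd c h g k = c k.
Proof. by rewrite /=; case: pselect. Qed.

Lemma gdist_wreath_cursor (G : graph) (o : G) (H : graph) (c : fsmap H o)
    (h k : H) :
  (gdist ((c, h) : wreath o H) ((c, k) : wreath o H) <= gdist h k)%N.
Proof.
apply: gdist_le; apply: (walk_map (f := fun x => (c, x)) _ (gdist_walk h k)).
by move=> a b ab; left.
Qed.

Lemma gdist_wreath_lamp (G : graph) (o : G) (H : graph) (c : fsmap H o)
    (h : H) (g : G) :
  (gdist ((c, h) : wreath o H) ((upd c h g, h) : wreath o H)
    <= gdist (c h) g)%N.
Proof.
apply: gdist_le; have cE : c = upd c h (c h).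
  by apply: fsmapP => k /=; case: pselect => //= ->.
(* A path of lamp values [x] from [c h] to [g] lifts to the states [upd c h x]; the first of them
   has to be recognized as [c]. *)
rewrite [X in walk _ _ (X, _)]cE.
apply: (walk_map (f := fun x => (upd c h x, h)) _ (gdist_walk _ _)) => a b ab.
by right; split=> [//|k kh|]; rewrite ?upd_same// !upd_other.
Qed.

(** The cursor visits the points of [s] in turn, each at the cost of [n] for the travel and [m] for
    setting the lamp to its value in [d]; the last [n] brings it to [k]. All stops lie in [P]. *)
Lemma gdist_wreath_le (G : graph) (o : G) (H : graph) (P : set H) (n m : nat)
    (s : seq {classic H}) (c d : fsmap H o) (h k : H) :
  (forall x y, P x -> P y -> (gdist x y <= n)%N) ->
  (forall x, (gdist (c x) (d x) <= m)%N) ->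
  P h -> P k -> (forall x : H, (x : {classic H}) \in s -> P x) ->
  (forall x : H, (x : {classic H}) \notin s -> c x = d x) ->
  (gdist ((c, h) : wreath o H) ((d, k) : wreath o H)
    <= size s * (n + m) + n)%N.
Proof.
move=> Pn + + Pk; elim: s c h => [|a s IH] c h cdm Ph sP cd.
  have -> : c = d by apply: fsmapP => x; exact: cd.
  exact: leq_trans (gdist_wreath_cursor _ _ _) (Pn _ _ Ph Pk).
have Pa : P a by apply: sP; exact: mem_head.
apply: (leq_trans (gdist_triangle ((c, a) : wreath o H) _ _)).
apply: (leq_trans (leq_add (leqnn _)
  (gdist_triangle ((upd c a (d a), a) : wreath o H) _ _))).
rewrite /= mulSn -!addnA; apply: leq_add.
  exact: leq_trans (gdist_wreath_cursor _ _ _) (Pn _ _ Ph Pa).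
apply: leq_add; first exact: leq_trans (gdist_wreath_lamp _ _ _) (cdm a).
apply: IH => // [x|x xs|x xs].
- have [->|xa] := pselect (x = a); first by rewrite upd_same gdistxx.
  by rewrite upd_other.
- by apply: sP; rewrite in_cons xs orbT.
have [->|xa] := pselect (x = a); first by rewrite upd_same.
rewrite upd_other//; apply: cd; rewrite in_cons negb_or xs andbT.
exact/eqP.
Qed.

(** Each edge moves the cursor or changes the lamp under it; [s] collects the cursor positions at
    the lamp changes. *)
Lemma wreath_walk (G : graph) (o : G) (H : graph) n (p q : wreath o H) :
  walk (@adj (wreath o H)) n p q ->
  [/\ (gdist p.2 q.2 <= n)%N, forall x, (gdist (p.1 x) (q.1 x) <= n)%N &
      exists s : seq {classic H}, [/\ (size s <= n)%N,
        forall x : H, (x : {classic H}) \in s -> (gdist p.2 x <= n)%N &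
        forall x : H, (x : {classic H}) \notin s -> p.1 x = q.1 x]].
Proof.
elim: n p => [p /= <-|n IH p /= [r pr /IH[hn cn [s [sn sP scd]]]]].
  by rewrite gdistxx; split=> // [x|]; [rewrite gdistxx|exists [::]].
case: pr => [[cE hh]|[hE cE cc]].
  split=> [|x|]; [|rewrite cE; exact: leqW|].
    exact: leq_trans (gdist_triangle r.2 _ _) (leq_add (gdist_adj hh) hn).
  exists s; rewrite cE; split=> // [|x /sP xs]; first exact: leqW.
  exact: leq_trans (gdist_triangle r.2 _ _) (leq_add (gdist_adj hh) xs).
rewrite hE; split=> [|x|]; first exact: leqW.
  have [->|xp] := pselect (x = p.2); last by rewrite cE// leqW.
  exact: leq_trans (gdist_triangle (r.1 p.2) _ _) (leq_add (gdist_adj cc) (cn _)).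
exists ((p.2 : {classic H}) :: s); split=> // x; rewrite in_cons.
  by case/orP=> [/eqP->|/sP/leqW//]; rewrite hE gdistxx.
by rewrite negb_or => /andP[/eqP xp /scd <-]; exact: cE.
Qed.

(** * Measure of the hyperplanes separating points of a finite set *)

Section HyperplaneMeasure.
Variables (R : realType) (Y : metricType R) (mu : hyperplane_measure Y).
Implicit Types (x y z : Y) (F : set Y).

(** The complement of [D] is the other member of the pair [W], and it contains [y]. *)
Lemma separatingC x y : separating x y `<=` separating y x.
Proof.
move=> W [hW [D [WD Dx Dy]]]; split=> //; exists (~` D); split=> //.
have [E [_ _ _ _ WE]] := hW; move: WD; rewrite WE => -[->|->].
  by right.
by rewrite setCK; left.
Qed.

(** On whichever side of [W] the point [z] lies, one of [x], [y] is on the other side. *)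
Lemma separating_triangle z x y :
  separating x y `<=` separating z x `|` separating z y.
Proof.
move=> W [hW [D [WD Dx Dy]]]; have [Dz|Dz] := pselect (D z).
  by right; split=> //; exists D.
by left; apply: separatingC; split=> //; exists D.
Qed.

Lemma measurable_separating x y :
  measurable (separating x y : set (g_sigma_algebraType (hm_algebra mu))).
Proof. by apply: sub_sigma_algebra; exact: hm_measurable. Qed.

Lemma measurable_hyperplanes_of F : finite_set F ->
  measurable (hyperplanes_of F : set (g_sigma_algebraType (hm_algebra mu))).
Proof.
move=> finF.
have -> : hyperplanes_of F =
    \bigcup_(xy in F `*` F) separating xy.1 xy.2.
  apply/seteqP; split=> [W [x [y [Fx Fy xy]]]|W [[x y] /= [Fx Fy] xy]].
    by exists (x, y).
  by exists x, y.
apply: fin_bigcup_measurable; first exact: finite_setX.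
by move=> xy _; exact: measurable_separating.
Qed.

(** The sets [separating z x], for [x] in [s], cover the hyperplanes of [F] and have measure at most
    [r] each; subadditivity concludes. *)
Lemma measure_hyperplanes_of_le z r F (s : seq Y) : finite_set F ->
  F `<=` [set` s] -> (forall x, x \in s -> mdist z x <= r) ->
  (mu (hyperplanes_of F) <= ((size s)%:R * r)%:E)%E.
Proof.
move=> finF Fs sr.
pose U := \big[setU/set0]_(x <- s) separating z x.
have [mU muU] : measurable (U : set (g_sigma_algebraType (hm_algebra mu))) /\
    (mu U <= ((size s)%:R * r)%:E)%E.
  rewrite /U; elim: s sr {Fs U} => [_|a s IH sr].
    by rewrite big_nil measure0 mul0r; split.
  have [|mU muU] := IH; first by move=> x xs; rewrite sr// in_cons xs orbT.
  have ma := measurable_separating z a.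
  rewrite big_cons; split; first exact: measurableU.
  apply: le_trans; first by apply: measureU2; [exact: ma|exact: mU].
  rewrite /= mulrS mulrDl mul1r EFinD; apply: leeD => //.
  by rewrite hm_separating lee_fin sr// mem_head.
apply: le_trans muU; apply: le_measure; rewrite ?inE//.
  exact: measurable_hyperplanes_of.
move=> W [x [y [/Fs/= xs /Fs/= ys /(separating_triangle z)]]].
by rewrite /U -bigcup_seq => -[] ?; [exists x|exists y].
Qed.

Lemma hmu_ge0 F : 0 <= hmu mu F.
Proof. by rewrite fine_ge0. Qed.

Lemma hmu_set1 y : hmu mu [set y] = 0.
Proof.
rewrite /hmu (_ : hyperplanes_of _ = set0) ?measure0//.
by apply/seteqP; split=> // W [_ [_ [-> -> [_ [D [_ ? ?]]]]]].
Qed.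

(** Since [fine] sends infinity to 0, bounds on the measure pass to [hmu] only once it is known to
    be finite. *)
Lemma measure_hyperplanes_of_fin F : finite_set F ->
  mu (hyperplanes_of F) \is a fin_num.
Proof.
move=> finF; have /finite_seqP[s Fs] := finF.
(* The centre [z] of the bound is taken in [F], so the empty set is treated apart; the common radius
   is the sum of all distances from [z]. *)
have [->|/set0P[z _]] := eqVneq F set0.
  rewrite (_ : hyperplanes_of _ = set0) ?measure0//.
  by apply/seteqP; split=> // W [? [? []]].
rewrite ge0_fin_numE; last exact: measure_ge0.
apply: le_lt_trans (@measure_hyperplanes_of_le z
  (\sum_(x <- s) mdist z x) F s finF _ _) (ltry _); first by rewrite Fs.
move=> x xs; rewrite (big_rem x)//= lerDl sumr_ge0// => i _; exact: mdist_ge0.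
Qed.

Lemma hmu_le z r F (s : seq Y) : finite_set F ->
  F `<=` [set` s] -> (forall x, x \in s -> mdist z x <= r) ->
  hmu mu F <= (size s)%:R * r.
Proof.
move=> finF Fs sr; rewrite -lee_fin fineK.
  exact: measure_hyperplanes_of_le sr.
exact: measure_hyperplanes_of_fin.
Qed.

Lemma mdist_le_hmu F x y : finite_set F -> F x -> F y -> mdist x y <= hmu mu F.
Proof.
move=> finF Fx Fy; rewrite -lee_fin -(hm_separating mu) fineK.
  apply: le_measure; rewrite ?inE; first exact: measurable_separating.
    exact: measurable_hyperplanes_of.
  by move=> W xy; exists x, y.
exact: measure_hyperplanes_of_fin.
Qed.

End HyperplaneMeasure.

(** * Sums of nonnegative terms with finite support *)

Section FiniteSupportSum.
Variables (R : realType) (T : choiceType) (f : T -> R) (s : seq T).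
Hypotheses (f_ge0 : forall x, 0 <= f x) (f_supp : forall x, x \notin s -> f x = 0).

Let fsbig_undup : \sum_(x \in [set: T]) f x = \sum_(x <- undup s) f x.
Proof.
rewrite (fsbigE (undup s)) ?undup_uniq//.
  by under eq_bigl do rewrite in_setT.
by move=> x _; rewrite mem_undup; exact: f_supp.
Qed.

Lemma fsbig_ge0 : 0 <= \sum_(x \in [set: T]) f x.
Proof. by rewrite fsbig_undup sumr_ge0. Qed.

Lemma le_fsbig x : f x <= \sum_(x \in [set: T]) f x.
Proof.
have [xs|/f_supp->] := boolP (x \in s); last exact: fsbig_ge0.
rewrite fsbig_undup (big_rem x) ?mem_undup//= lerDl.
exact: sumr_ge0.
Qed.

Lemma fsbig_le r : 0 <= r -> (forall x, f x <= r) ->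
  \sum_(x \in [set: T]) f x <= (size s)%:R * r.
Proof.
move=> r0 fr; rewrite fsbig_undup.
apply: (@le_trans _ _ (\sum_(x <- undup s) r)); first exact: ler_sum.
rewrite big_const_seq count_predT iter_addr_0 -[leLHS]mulr_natl ler_wpM2r//.
by rewrite ler_nat size_undup.
Qed.

End FiniteSupportSum.

(** * Distances between images under [wreath_map] *)

Section WreathMapTheory.
Variables (R : realType) (G H : graph) (o : G) (X Y : metricType R).
Variables (mu : hyperplane_measure Y) (Phi : G -> X) (Psi : H -> Y).
Implicit Types p q : wreath o H.
Hypothesis injPsi : injective Psi.

Lemma wreath_lampE (c : H -> G) h : wreath_lamp o Phi Psi c (Psi h) = Phi (c h).
Proof.
rewrite /wreath_lamp; case: pselect => [e|[]]; last by exists h.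
by case: cid => k /= /injPsi ->.
Qed.

(** Off the image of [Psi] both maps take the value [Phi o]. *)
Lemma wreath_lamp_neq (c d : H -> G) y :
  wreath_lamp o Phi Psi c y <> wreath_lamp o Phi Psi d y ->
  exists2 h, Psi h = y & c h <> d h.
Proof.
have [[h <-]|ny] := pselect (exists h, Psi h = y).
  by rewrite !wreath_lampE => cd; exists h => // E; apply: cd; rewrite E.
by rewrite /wreath_lamp; case: pselect.
Qed.

(** The argument of [hmu] in [diadem_dist] for the images of [p] and [q]. Its last piece is the
    image under [Psi] of the lamps whose values differ after applying [Phi]. *)
Definition wreath_support (p q : wreath o H) : set Y :=
  [set Psi p.2] `|` [set Psi q.2] `|`
  [set y | wreath_lamp o Phi Psi p.1 y <> wreath_lamp o Phi Psi q.1 y].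

Lemma finite_wreath_support p q : finite_set (wreath_support p q).
Proof.
rewrite /wreath_support !finite_setU; split; first by split; exact: finite_set1.
apply: (@sub_finite_set _ _
  (Psi @` ([set h | p.1 h <> o] `|` [set h | q.1 h <> o]))).
  move=> y /wreath_lamp_neq[h hy pq]; exists h => //=.
  by apply: contrapT => /not_orP[/contrapT po /contrapT qo]; rewrite po qo in pq.
by apply: finite_image; rewrite finite_setU; split; exact: fsmap_fin.
Qed.

Lemma wreath_mapE p q :
  diadem_dist mu (wreath_map o Phi Psi p) (wreath_map o Phi Psi q) =
  2 * hmu mu (wreath_support p q) +
  \sum_(y \in [set: Y])
    mdist (wreath_lamp o Phi Psi p.1 y) (wreath_lamp o Phi Psi q.1 y).
Proof. by rewrite /diadem_dist /= !hmu_set1 !subr0. Qed.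

Lemma mdist_wreath_lamp_supp p q : exists s : seq Y, forall y, y \notin s ->
  mdist (wreath_lamp o Phi Psi p.1 y) (wreath_lamp o Phi Psi q.1 y) = 0.
Proof.
have /finite_seqP[s sE] := finite_wreath_support p q; exists s => y ys.
have [->|pq] := pselect (wreath_lamp o Phi Psi p.1 y = wreath_lamp o Phi Psi q.1 y).
  exact: mdistxx.
have : wreath_support p q y by right.
by rewrite sE /= (negbTE ys).
Qed.

Lemma mdist_support_le p q x y : wreath_support p q x -> wreath_support p q y ->
  mdist x y <=
    diadem_dist mu (wreath_map o Phi Psi p) (wreath_map o Phi Psi q).
Proof.
move=> px py; rewrite wreath_mapE.
apply: le_trans (mdist_le_hmu mu (finite_wreath_support p q) px py) _.
have [s s0] := mdist_wreath_lamp_supp p q.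
rewrite mulr2n mulrDl mul1r -addrA lerDl addr_ge0 ?hmu_ge0//.
by apply: fsbig_ge0 s0 => z; exact: mdist_ge0.
Qed.

Lemma mdist_lamp_le p q h :
  mdist (Phi (p.1 h)) (Phi (q.1 h)) <=
    diadem_dist mu (wreath_map o Phi Psi p) (wreath_map o Phi Psi q).
Proof.
rewrite wreath_mapE; have [s s0] := mdist_wreath_lamp_supp p q.
rewrite -!wreath_lampE; apply: le_trans (le_fsbig _ s0 (Psi h)) _.
  by move=> z; exact: mdist_ge0.
by rewrite lerDr mulr_ge0// hmu_ge0.
Qed.

(** The support consists of two cursors and at most [n] lamps, all within [rH] of [Psi p.2], whence
    [n.+2]; the sum has at most [n] nonzero terms, each at most [rG]. *)
Lemma diadem_dist_wreath_le p q n (rG rH : R) :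
  (forall a b, (gdist a b <= n)%N -> mdist (Phi a) (Phi b) <= rG) ->
  (forall a b, (gdist a b <= n)%N -> mdist (Psi a) (Psi b) <= rH) ->
  (gdist p q <= n)%N ->
  diadem_dist mu (wreath_map o Phi Psi p) (wreath_map o Phi Psi q) <=
    2 * (n.+2%:R * rH) + n%:R * rG.
Proof.
move=> PhiR PsiR pqn.
have rG0 : 0 <= rG.
  by apply: le_trans (PhiR o o _); rewrite ?gdistxx// mdist_ge0.
have rH0 : 0 <= rH.
  by apply: le_trans (PsiR p.2 p.2 _); rewrite ?gdistxx// mdist_ge0.
have [hn cn [s [sn sP scd]]] := wreath_walk (gdist_walk p q).
pose t := [seq Psi x | x : {classic H} <- s].
have tn : (size t <= n)%N by rewrite size_map (leq_trans sn).
have tP y : wreath_lamp o Phi Psi p.1 y <> wreath_lamp o Phi Psi q.1 y -> y \in t.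
  move=> /wreath_lamp_neq[h <- pq]; apply: (map_f (fun x : {classic H} => Psi x)).
  by apply/negPn/negP => /scd.
rewrite wreath_mapE; apply: lerD.
  rewrite ler_pM2l//.
  apply: le_trans (@hmu_le _ _ mu (Psi p.2) rH _ (Psi p.2 :: Psi q.2 :: t) _ _ _) _.
  - exact: finite_wreath_support.
  - by move=> y /= [[->|->]|/tP yt]; rewrite !inE ?eqxx ?yt ?orbT.
  - move=> y; rewrite !inE => /or3P[/eqP->|/eqP->|/mapP[x xs ->]]; apply: PsiR.
    + by rewrite gdistxx.
    + exact: leq_trans pqn.
    + exact: leq_trans (sP _ xs) pqn.
  - by rewrite ler_wpM2r// ler_nat.
apply: (@le_trans _ _ ((size t)%:R * rG)); last by rewrite ler_wpM2r// ler_nat.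
apply: fsbig_le => // y.
- move=> /negP yt; have [->|/tP//] := pselect
    (wreath_lamp o Phi Psi p.1 y = wreath_lamp o Phi Psi q.1 y).
  exact: mdistxx.
- have [[h <-]|ny] := pselect (exists h, Psi h = y).
    by rewrite !wreath_lampE; apply/PhiR/(leq_trans (cn h)).
  have [->|/wreath_lamp_neq[h hy]] := pselect
    (wreath_lamp o Phi Psi p.1 y = wreath_lamp o Phi Psi q.1 y).
    by rewrite mdistxx.
  by case: ny; exists h.
Qed.

(** The points of [H] sent into the support have pairwise distances at most [nH], so they lie in one
    ball about [p.2], covered by [K] points. By injectivity of [Phi], all differing lamps are among
    them. *)
Lemma gdist_wreath_map_le p q K (nG nH : nat) :
  (forall h : H, exists2 s : seq {classic H}, (size s <= K)%N &
    forall k : H, (gdist h k <= nH)%N -> (k : {classic H}) \in s) ->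
  injective Phi ->
  (forall a b, mdist (Phi a) (Phi b) <=
    diadem_dist mu (wreath_map o Phi Psi p) (wreath_map o Phi Psi q) ->
    (gdist a b <= nG)%N) ->
  (forall a b, mdist (Psi a) (Psi b) <=
    diadem_dist mu (wreath_map o Phi Psi p) (wreath_map o Phi Psi q) ->
    (gdist a b <= nH)%N) ->
  (gdist p q <= K * (nH + nG) + nH)%N.
Proof.
move=> ballK injPhi PhiR PsiR; pose P : set H := [set x | wreath_support p q (Psi x)].
have Pd x y : P x -> P y -> (gdist x y <= nH)%N.
  by move=> Px Py; apply: PsiR; exact: mdist_support_le.
have Pp : P p.2 by left; left.
have Pq : P q.2 by left; right.
have [s sK sP] := ballK p.2.
(* Keeping only the points of [P] makes consecutive stops at most [nH] apart; the ball alone would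
   only give [2 * nH]. *)
pose t := [seq x : {classic H} <- s | `[< P x >]].
apply: (@leq_trans (size t * (nH + nG) + nH)); last first.
  by rewrite leq_add2r leq_mul2r size_filter (leq_trans (count_size _ _) sK) orbT.
rewrite [p]surjective_pairing [q]surjective_pairing.
apply: (gdist_wreath_le (P := P)) => // [x|x|x].
- by apply: PhiR; exact: mdist_lamp_le.
- by rewrite mem_filter => /andP[/asboolP].
move=> xt; apply: contrapT => pq; case/negP: xt.
have Px : P x by right; rewrite /= !wreath_lampE => /injPhi.
by rewrite mem_filter; apply/andP; split; [exact/asboolP|exact/sP/Pd].
Qed.

End WreathMapTheory.

Theorem proposition4p3 (R : realType) (G H : graph) (o : G)
    (X Y : metricType R) (mu : hyperplane_measure Y)
    (Phi : G -> X) (Psi : H -> Y)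
    (medX : median_space X) (medY : median_space Y)
    (injPhi : injective Phi) (injPsi : injective Psi)
    (Hulf : uniformly_locally_finite H)
    (cPhi : coarse_embedding (fun a b : G => (gdist a b)%:R : R)
              (@mdist R X) Phi)
    (cPsi : coarse_embedding (fun a b : H => (gdist a b)%:R : R)
              (@mdist R Y) Psi) :
  coarse_embedding (fun p q : wreath o H => (gdist p q)%:R : R)
    (@diadem_dist R X (Phi o) Y mu) (wreath_map o Phi Psi).
Proof.
have [upG lowG] := (graph_coarse_embeddingP (fun x y => mdist_ge0 _ _)).1 cPhi.
have [upH lowH] := (graph_coarse_embeddingP (fun x y => mdist_ge0 _ _)).1 cPsi.
apply/graph_coarse_embeddingP => [p q|].
  (* Nonnegativity of the distance between images: it dominates the distance between the values of
     any one lamp. *)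
  exact: le_trans (mdist_ge0 _ _) (mdist_lamp_le mu Phi injPsi p q p.2).
split=> [n|r].
  have [rG PhiR] := upG n; have [rH PsiR] := upH n.
  by exists (2 * (n.+2%:R * rH) + n%:R * rG) => p q; exact: diadem_dist_wreath_le.
have [nG PhiN] := lowG r; have [nH PsiN] := lowH r.
have [K ballK] := ball_cover Hulf nH.
exists (K * (nH + nG) + nH)%N => p q pqr.
apply: (gdist_wreath_map_le (mu := mu) injPsi ballK injPhi) => a b ab.
  exact/PhiN/(le_trans ab).
exact/PsiN/(le_trans ab).
Qed.
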